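(* Let $\kappa>0$, $\omega^2\ge0$, $b_1,\dots,b_n\ge0$ be real constants with $c:=\kappa\omega^2\neq0$, and let $$H(\mathbf p,\mathbf q)=\frac{\mathbf p^2-c+\sum_{j=1}^n b_jq_j^{-2}}{2(\kappa+\mathbf q^2)}.$$ Let $t\mapsto(\mathbf q(t),\mathbf p(t))$ be a solution of Hamilton's equations of $H$ such that the constant $E:=2H$ is positive. Let $C$ and $I_i$ ($1\le i\le n$) be the constant values along this solution of the first integrals $$C=\mathbf q^2\Big(\mathbf p^2+\sum_{j=1}^n b_jq_j^{-2}\Big)-(\mathbf p\cdot\mathbf q)^2,\qquad I_i=p_i^2-2Hq_i^2+b_iq_i^{-2},$$ and put $$\alpha=\tfrac12\Big(\kappa-\frac cE\Big),\qquad \gamma=\Big(\tfrac14\Big(\kappa+\frac cE\Big)^2+\frac CE\Big)^{1/2},\qquad \alpha_i=-\frac{I_i}{2E},\qquad \gamma_i=\Big(\alpha_i^2+\frac{b_i}{E}\Big)^{1/2}\ge0.$$ Let $x=\kappa+\mathbf q^2$ and $Q_i=q_i^2$. Then the radial motion is given by $$\pm2\sqrt E\,(t-\tau)=\sqrt{(x-\alpha)^2-\gamma^2}+\alpha\cosh^{-1}\Big(\frac{x-\alpha}{\gamma}\Big)$$ with $\tau$ an arbitrary constant; this gives $t$ as a monotonic function of $x$, so that the relation is globally invertible in each half-orbit. Parametrizing the trajectory by $x$, the full solution is given by $$Q_i=\alpha_i+\gamma_i\cosh(X+\varphi_i)=\alpha_i+\gamma^{-1}\gamma_i\cosh\varphi_i\,(x-\alpha)+\gamma_i\sinh\varphi_i\,\Big|1-\Big(\frac{x-\alpha}{\gamma}\Big)^2\Big|^{1/2},\qquad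 1\le i\le n,$$ where $X:=\cosh^{-1}\big(\gamma^{-1}(x-\alpha)\big)$ and $\varphi_1,\dots,\varphi_n$ are constants. These quantities satisfy the compatibility conditions $$\sum_{i=1}^n\alpha_i+\kappa=\alpha,\qquad \sum_{i=1}^n\gamma_i\cosh\varphi_i=\gamma,\qquad \sum_{i=1}^n\gamma_i\sinh\varphi_i=0,$$ the last of which is the constraint $\sum_{i=1}^n\sinh\varphi_i\,(\alpha_i^2+E^{-1}b_i)^{1/2}=0$ on the parameters $\{\alpha_i,\varphi_j\}$, and the energy is expressed in terms of the $\alpha_i$ as $$E=-\frac{c}{\kappa+2\sum_{i=1}^n\alpha_i}.$$ All the orbits with positive energy $E$ are recovered through an appropriate choice of the $2n$ parameters $\{\tau,\alpha_i,\varphi_j: 1\le i\le n-1,\ 1\le j\le n\}$, the remaining quantities being expressed in terms of these by means of the relations above.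
   Context: Notation: $\mathbf p,\mathbf q\in\mathbb R^n$, $\mathbf u^2=\sum_i u_i^2$, and phase space carries the standard symplectic form $d\mathbf q\wedge d\mathbf p$; Hamilton's equations are $\dot q_i=\partial H/\partial p_i$, $\dot p_i=-\partial H/\partial q_i$. A term $b_jq_j^{-2}$ with $b_j=0$ is understood to be absent, and $q_j\neq0$ when $b_j\neq0$. A half-orbit is a part of the trajectory on which $x(t)=\kappa+\mathbf q(t)^2$ is strictly monotonic in $t$. $\cosh^{-1}$ denotes the inverse hyperbolic cosine. All square roots are non-negative.
   Formalization: The formula for Q_i is claimed only if γ_i≠0 or q_i≡0 (it is false otherwise); the two φ-sum conditions and the recovery of orbits are claimed only if this holds for all i. On half-orbits where x decreases, φ_i is replaced by −φ_i. *)

(* Defs.v *)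
From HB Require Import structures.
From mathcomp Require Import all_boot all_order all_algebra.
From mathcomp Require Import ring lra.
From mathcomp Require Import all_classical all_reals all_analysis.

Set Implicit Arguments.
Unset Strict Implicit.
Unset Printing Implicit Defensive.

Import Order.TTheory GRing.Theory Num.Theory.
Import numFieldNormedType.Exports.

Local Open Scope classical_set_scope.
Local Open Scope ring_scope.

Definition cosh (R : realType) (u : R) : R := (expR u + expR (- u)) / 2.
Definition sinh (R : realType) (u : R) : R := (expR u - expR (- u)) / 2.

(* The inverse of cosh : [0, +oo[ -> [1, +oo[ ; the value is 0 off [1, +oo[. *)
Definition arcosh (R : realType) (y : R) : R :=
  xget 0 [set u : R | 0 <= u /\ cosh u = y].

Lemma cosh_sqrB1 (R : realType) (u : R) : cosh u ^+ 2 - 1 = sinh u ^+ 2.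
Proof.
have e1 : expR u * expR (- u) = 1 by rewrite -expRD subrr expR0.
by rewrite /cosh /sinh -[X in _ - X]e1; field.
Qed.

Lemma sinh_ge0 (R : realType) (u : R) : 0 <= u -> 0 <= sinh u.
Proof.
by move=> u0; rewrite /sinh divr_ge0// subr_ge0 ler_expR ge0_cp.
Qed.

Lemma cosh_inj_ge0 (R : realType) (u v : R) :
  0 <= u -> 0 <= v -> cosh u = cosh v -> u = v.
Proof.
move=> u0 v0 uv; apply: expR_inj.
have suv : sinh u = sinh v.
  by apply/eqP; rewrite -(@eqrXn2 _ 2) ?sinh_ge0// -!cosh_sqrB1 uv.
by move: uv suv; rewrite /cosh /sinh; lra.
Qed.

Lemma cosh_surj_ge1 (R : realType) (y : R) :
  1 <= y -> exists u : R, 0 <= u /\ cosh u = y.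
Proof.
move=> y1; set s := Num.sqrt (y ^+ 2 - 1).
have s0 : 0 <= s by exact: sqrtr_ge0.
have s2 : s ^+ 2 = y ^+ 2 - 1 by rewrite sqr_sqrtr//; nra.
have ys0 : 0 < y + s by lra.
exists (ln (y + s)); split; first by rewrite ln_ge0//; lra.
rewrite /cosh expRN lnK ?posrE//.
have -> : (y + s)^-1 = y - s.
  apply: (mulfI (lt0r_neq0 ys0)); rewrite mulfV ?lt0r_neq0//.
  have -> : (y + s) * (y - s) = y ^+ 2 - s ^+ 2 by ring.
  by rewrite s2; ring.
by field.
Qed.

Lemma arcosh_spec (R : realType) (y : R) :
  1 <= y -> 0 <= arcosh y /\ cosh (arcosh y) = y.
Proof.
by move=> /cosh_surj_ge1[u yu]; rewrite /arcosh; case: xgetP => [v -> //|/(_ u)].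
Qed.

Lemma coshK (R : realType) (u : R) : 0 <= u -> arcosh (cosh u) = u.
Proof.
move=> u0; rewrite /arcosh; case: xgetP => [v _ [v0 vu]|/(_ u)/=].
  exact: cosh_inj_ge0 vu.
by case.
Qed.

Definition dot (R : realType) (n : nat) (u v : 'rV[R]_n) : R :=
  \sum_(i < n) u 0 i * v 0 i.

(* A term with b j = 0 vanishes identically, also where q 0 j = 0. *)
Definition centrifugal (R : realType) (n : nat) (b : 'I_n -> R)
    (q : 'rV[R]_n) : R :=
  \sum_(j < n) b j * q 0 j ^- 2.

Definition hamiltonian (R : realType) (n : nat) (kappa c : R) (b : 'I_n -> R)
    (p q : 'rV[R]_n) : R :=
  (dot p p - c + centrifugal b q) / (2 * (kappa + dot q q)).

Definition integralC (R : realType) (n : nat) (b : 'I_n -> R)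
    (p q : 'rV[R]_n) : R :=
  dot q q * (dot p p + centrifugal b q) - dot p q ^+ 2.

Definition integralI (R : realType) (n : nat) (kappa c : R) (b : 'I_n -> R)
    (i : 'I_n) (p q : 'rV[R]_n) : R :=
  p 0 i ^+ 2 - 2 * hamiltonian kappa c b p q * q 0 i ^+ 2 + b i * q 0 i ^- 2.

(* (q, p) solves Hamilton's equations of H on the time interval J; the partial *)
(* derivatives of H are directional derivatives along the standard basis.      *)
Definition hamilton_solution (R : realType) (n : nat)
    (H : 'rV[R]_n -> 'rV[R]_n -> R) (J : set R) (q p : R -> 'rV[R]_n) : Prop :=
  forall t, J t -> forall i : 'I_n,
    is_derive t 1 (fun s => q s 0 i)
      ('D_(delta_mx 0 i) (fun p' => H p' (q t)) (p t)) /\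
    is_derive t 1 (fun s => p s 0 i)
      (- 'D_(delta_mx 0 i) (fun q' => H (p t) q') (q t)).

(* S is a nondegenerate subinterval of J on which x is strictly increasing     *)
(* (sigma = 1) or strictly decreasing (sigma = -1).                            *)
Definition half_orbit (R : realType) (J : set R) (x : R -> R) (sigma : R)
    (S : set R) : Prop :=
  [/\ S `<=` J, is_interval S, exists s t, [/\ S s, S t & s < t] &
      (sigma = 1 /\ forall s t, S s -> S t -> s < t -> x s < x t) \/
      (sigma = -1 /\ forall s t, S s -> S t -> s < t -> x t < x s)].

Definition radial_fun (R : realType) (alpha gamma x : R) : R :=
  Num.sqrt ((x - alpha) ^+ 2 - gamma ^+ 2)
  + alpha * arcosh ((x - alpha) / gamma).

Definition radial_law (R : realType) (J : set R) (x : R -> R)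
    (E alpha gamma tau : R) : Prop :=
  forall (sigma : R) (S : set R), half_orbit J x sigma S ->
  forall t, S t ->
    sigma * (2 * Num.sqrt E * (t - tau)) = radial_fun alpha gamma (x t).

(* Evolution of one coordinate square Q along a trajectory. Since arcosh >= 0, *)
(* reversing the direction of motion along x amounts to changing the sign of   *)
(* phi: the same constant phi serves both half-orbits of a trajectory.         *)
Definition angular_law (R : realType) (J : set R) (x Q : R -> R)
    (alpha gamma alpha_i gamma_i phi : R) : Prop :=
  forall (sigma : R) (S : set R), half_orbit J x sigma S ->
  forall t, S t ->
    let X := arcosh (gamma^-1 * (x t - alpha)) in
    Q t = alpha_i + gamma_i * cosh (X + sigma * phi) /\
    Q t = alpha_i
          + gamma^-1 * gamma_i * cosh (sigma * phi) * (x t - alpha)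
          + gamma_i * sinh (sigma * phi)
            * Num.sqrt `|1 - ((x t - alpha) / gamma) ^+ 2|.

(* The family a_0, ..., a_(n-1), z indexed by 'I_n.+1. *)
Definition ord_rcons (T : Type) (n : nat) (a : 'I_n -> T) (z : T)
    (i : 'I_n.+1) : T :=
  if unlift ord_max i is Some j then a j else z.

(* Main.v *)
Require Import Defs.
From HB Require Import structures.
From mathcomp Require Import all_boot all_order all_algebra.
From mathcomp Require Import ring lra.
From mathcomp Require Import all_classical all_reals all_analysis.

Set Implicit Arguments.
Unset Strict Implicit.
Unset Printing Implicit Defensive.

Import Order.TTheory GRing.Theory Num.Theory.
Import numFieldNormedType.Exports.

Local Open Scope classical_set_scope.
Local Open Scope ring_scope.

(** Writing x = kappa + q^2 and s = p.q, Hamilton's equations give x' = 2 s / x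
    and s' = 2 E (x - alpha) / x, so that (x - alpha, s / sqrt E) runs along the
    hyperbola X^2 - S^2 = gamma^2.  Its hyperbolic angle theta, given by
    x = alpha + gamma cosh theta and s = sqrt E gamma sinh theta, satisfies
    theta' = 2 sqrt E / x > 0.  Hence 2 sqrt E (t - tau) =
    gamma sinh theta + alpha theta, and a half-orbit is a time interval on which
    theta has constant sign.  With respect to theta, each pair
    (q_i^2 - alpha_i, p_i q_i / sqrt E) obeys the same linear system Y' = P,
    P' = Y, with Y^2 - P^2 = gamma_i^2; this yields the phases phi_i. *)

(** * One-variable calculus on a time interval *)

Section RealDerivatives.
Variable R : realType.
Implicit Types (f g : R -> R) (J : set R) (t u v : R).

Lemma is_derive_fctD f g t df dg : is_derive t 1 f df -> is_derive t 1 g dg ->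
  is_derive t 1 (fun s => f s + g s) (df + dg).
Proof. by move=> ? ?; exact: is_deriveD. Qed.

Lemma is_derive_fctM f g t df dg : is_derive t 1 f df -> is_derive t 1 g dg ->
  is_derive t 1 (fun s => f s * g s) (df * g t + f t * dg).
Proof.
move=> f' g'; apply: is_derive_eq; rewrite /GRing.scale/=.
by rewrite addrC mulrC.
Qed.

Lemma is_derive_fctZ f t a df : is_derive t 1 f df ->
  is_derive t 1 (fun s => a * f s) (a * df).
Proof.
move=> f'; apply: is_derive_eq (is_derive_fctM (is_derive_cst a t 1) f') _.
by rewrite /cst/= mul0r add0r.
Qed.

Lemma is_derive_fct_sqr f t df : is_derive t 1 f df ->
  is_derive t 1 (fun s => f s ^+ 2) (2 * f t * df).
Proof.
move=> f'; have := is_derive_fctM f' f'.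
under eq_fun do rewrite -expr2.
by move/is_derive_eq; apply; ring.
Qed.

Lemma is_derive_fct_sum n (h : 'I_n -> R -> R) t (dh : 'I_n -> R) :
  (forall i, is_derive t 1 (h i) (dh i)) ->
  is_derive t 1 (fun s => \sum_i h i s) (\sum_i dh i).
Proof.
move=> h'; have := is_derive_sum h'.
by congr is_derive; apply/funext => s; rewrite fct_sumE.
Qed.

Lemma is_derive_fctV f t df : f t != 0 -> is_derive t 1 f df ->
  is_derive t 1 (fun s => (f s)^-1) (- (df / f t ^+ 2)).
Proof.
move=> ft f'; apply: is_derive_eq (is_deriveV ft f') _.
by rewrite /GRing.scale/= mulNr mulrC.
Qed.

(* The alternative a = 0 covers the absent centrifugal terms, whose f may
   vanish. *)
Lemma is_derive_inv_sqr f t a df : (a = 0 \/ f t != 0) ->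
  is_derive t 1 f df ->
  is_derive t 1 (fun s => a * f s ^- 2) (- (2 * a * f t ^- 3 * df)).
Proof.
move=> [->|ft] f'.
  rewrite [X in is_derive _ _ X](_ : _ = cst 0); last first.
    by apply/funext => s; rewrite mul0r.
  by apply: is_derive_eq; rewrite mulr0 !mul0r oppr0.
have f2 : f t ^+ 2 != 0 by rewrite expf_neq0.
have := is_derive_fctZ a
  (is_derive_fctV (f := fun s => f s ^+ 2) f2 (is_derive_fct_sqr f')).
by move/is_derive_eq; apply; field.
Qed.

Lemma is_derive_expRN u : is_derive u 1 (fun s : R => expR (- s)) (- expR (- u)).
Proof.
have n : is_derive u 1 (fun s : R => - s) (-1) by exact: is_deriveN.
by rewrite -mulrN1; exact: (is_derive1_comp (is_derive_expR (- u)) n).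
Qed.

Lemma is_derive_cosh u : is_derive u 1 (@cosh R) (sinh u).
Proof.
have := is_derive_fctZ 2^-1 (is_derive_fctD (is_derive_expR u) (is_derive_expRN u)).
rewrite /sinh mulrC; congr is_derive; apply/funext => s.
by rewrite /cosh mulrC.
Qed.

Lemma is_derive_sinh u : is_derive u 1 (@sinh R) (cosh u).
Proof.
have e : is_derive u 1 (fun s : R => - expR (- s)) (expR (- u)).
  by rewrite -[X in is_derive _ _ _ X]opprK; exact: is_deriveN (is_derive_expRN u).
have := is_derive_fctZ 2^-1 (is_derive_fctD (is_derive_expR u) e).
rewrite /cosh mulrC; congr is_derive; apply/funext => s.
by rewrite /sinh mulrC.
Qed.

Lemma is_derive_fct_cosh f t df : is_derive t 1 f df ->
  is_derive t 1 (fun s => cosh (f s)) (sinh (f t) * df).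
Proof. by move=> f'; exact: (is_derive1_comp (is_derive_cosh _) f'). Qed.

Lemma is_derive_fct_sinh f t df : is_derive t 1 f df ->
  is_derive t 1 (fun s => sinh (f s)) (cosh (f t) * df).
Proof. by move=> f'; exact: (is_derive1_comp (is_derive_sinh _) f'). Qed.

Lemma is_derive_fct_ln f t df : 0 < f t -> is_derive t 1 f df ->
  is_derive t 1 (fun s => ln (f s)) ((f t)^-1 * df).
Proof. by move=> ft f'; exact: (is_derive1_comp (is_derive1_ln ft) f'). Qed.

(** Since [J] is an interval, it contains the whole segment from [s] to [t]; differentiability on
    [J] alone is therefore enough, and the intermediate point lies in [J] again. *)
Lemma MVT_interval J f df : is_interval J ->
  (forall t, J t -> is_derive t 1 f (df t)) ->
  forall s t, J s -> J t -> s < t ->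
  exists2 c, J c /\ s < c < t & f t - f s = df c * (t - s).
Proof.
move=> Ji f' s t Js Jt st.
have Jst c : s <= c <= t -> J c by move=> h; exact: (Ji _ _ Js Jt).
have [c| |c cst e] := @MVT R f df s t st.
- by rewrite in_itv/= => /andP[? ?]; apply/f'/Jst; rewrite !ltW.
- apply: derivable_within_continuous => c; rewrite in_itv/= => /Jst Jc.
  exact: (@ex_derive _ _ _ _ _ _ _ (f' _ Jc)).
- move: cst; rewrite in_itv/= => /[dup] cst /andP[? ?].
  by exists c => //; split => //; apply: Jst; rewrite !ltW.
Qed.

Lemma derive0_constant J f : is_interval J ->
  (forall t, J t -> is_derive t 1 f 0) ->
  forall s t, J s -> J t -> f s = f t.
Proof.
move=> Ji f' s t Js Jt; wlog st : s t Js Jt / s < t.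
  move=> H; have [st|ts|->//] := ltgtP s t; first exact: H.
  by apply/esym; exact: H.
have [c _ /eqP] := MVT_interval (df := fun=> 0) Ji f' Js Jt st.
by rewrite mul0r subr_eq0 => /eqP.
Qed.

Lemma derive_gt0_increasing J f df : is_interval J ->
  (forall t, J t -> is_derive t 1 f (df t)) -> (forall t, J t -> 0 < df t) ->
  forall s t, J s -> J t -> s < t -> f s < f t.
Proof.
move=> Ji f' df0 s t Js Jt st; have [c [Jc _] e] := MVT_interval Ji f' Js Jt st.
by rewrite -subr_gt0 e mulr_gt0 ?subr_gt0 ?df0.
Qed.

End RealDerivatives.

(** * Hyperbolic functions and the parametrization of a hyperbola *)

Section Hyperbolic.
Variable R : realType.
Implicit Types (u v y : R).

Lemma coshN u : cosh (- u) = cosh u.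
Proof. by rewrite /cosh opprK addrC. Qed.

Lemma sinhN u : sinh (- u) = - sinh u.
Proof. by rewrite /sinh opprK -mulNr opprB. Qed.

Lemma sinh0 : sinh 0 = 0 :> R.
Proof. by rewrite /sinh oppr0 expR0 subrr mul0r. Qed.

Lemma coshD u v : cosh (u + v) = cosh u * cosh v + sinh u * sinh v.
Proof. by rewrite /cosh /sinh opprD !expRD; field. Qed.

Lemma cosh_ge1 u : 1 <= cosh u.
Proof.
have p : 0 < cosh u by rewrite /cosh divr_gt0 ?addr_gt0 ?expR_gt0.
have := sqr_ge0 (sinh u); rewrite -cosh_sqrB1; nra.
Qed.

Lemma cosh_sqrB_sinh_sqr u : cosh u ^+ 2 - sinh u ^+ 2 = 1.
Proof. by rewrite -cosh_sqrB1; ring. Qed.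

(** The derivative of [sinh] is [cosh], which is at least 1. This bound later compensates for a
    negative [alpha] in the radial function. *)
Lemma sinhB_ge u v : u <= v -> v - u <= sinh v - sinh u.
Proof.
rewrite le_eqVlt => /predU1P[->|uv]; first by rewrite !subrr.
have sinh' t : [set: R] t -> is_derive t 1 (@sinh R) (cosh t).
  by move=> _; exact: is_derive_sinh.
have Ti : is_interval [set: R] by [].
have [c _ ->] := MVT_interval Ti sinh' (s := u) (t := v) I I uv.
by rewrite ler_peMl ?cosh_ge1 // subr_ge0 ltW.
Qed.

Lemma cosh_lt_ge0 u v : 0 <= u -> u < v -> cosh u < cosh v.
Proof.
move=> u0 uv; 
have := cosh_ge1 u; have := cosh_ge1 v.
have := cosh_sqrB_sinh_sqr u; have := cosh_sqrB_sinh_sqr v.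
have := sinh_ge0 u0; have := sinhB_ge (ltW uv); nra.
Qed.

Lemma sinh_surj y : exists u, sinh u = y.
Proof.
have y1 : 1 <= Num.sqrt (1 + y ^+ 2) by rewrite -{1}[1]sqrtr1 ler_sqrt; nra.
(* A nonnegative u with cosh u = sqrt (1 + y^2) has sinh u = y up to sign; oddness of [sinh] settles
   the sign. *)
have [u [u0 uy]] := cosh_surj_ge1 y1.
have s2 : sinh u ^+ 2 = y ^+ 2 by rewrite -cosh_sqrB1 uy sqr_sqrtr; [ring|nra].
move/eqP: s2; rewrite eqf_sqr => /orP[/eqP <-|/eqP e]; first by exists u.
by exists (- u); rewrite sinhN e opprK.
Qed.

(* (A, B) lies on the branch A > 0 of the hyperbola A^2 - B^2 = r^2. *)
Lemma hyperbola_param (A B r : R) : 0 < A -> 0 < r -> A ^+ 2 - B ^+ 2 = r ^+ 2 ->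
  exists u, A = r * cosh u /\ B = r * sinh u.
Proof.
move=> A0 r0 ABr; have [u uB] := sinh_surj (B / r).
have eB : B = r * sinh u by rewrite uB mulrC divfK// gt_eqF.
exists u; split => //; apply/eqP; rewrite -(@eqrXn2 _ 2)//; last first.
- by rewrite mulr_ge0 ?(ltW r0)// (le_trans ler01)// cosh_ge1.
- exact: ltW.
- apply/eqP; have := cosh_sqrB_sinh_sqr u; move: ABr; rewrite eB; nra.
Qed.
End Hyperbolic.

(** * The radial function as an increasing bijection *)

Section RadialFunction.
Variables (R : realType) (alpha gamma : R).
Hypotheses (gamma_gt0 : 0 < gamma) (alpha_gamma_gt0 : 0 < alpha + gamma).
Implicit Types (u v y z : R).

(** For u >= 0 the substitution x = alpha + gamma cosh u turns the square root into gamma sinh u and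
    the inverse hyperbolic cosine into u. The radial law becomes an equation of Kepler type in u. *)
Lemma radial_fun_cosh u : 0 <= u ->
  radial_fun alpha gamma (alpha + gamma * cosh u) = gamma * sinh u + alpha * u.
Proof.
move=> u0; rewrite /radial_fun (_ : alpha + _ - alpha = gamma * cosh u); last by ring.
rewrite [X in arcosh X]mulrC mulKf ?gt_eqF// coshK//.
have -> : (gamma * cosh u) ^+ 2 - gamma ^+ 2 = (gamma * sinh u) ^+ 2.
  by rewrite [in RHS]exprMn -cosh_sqrB1; ring.
by rewrite sqrtr_sqr ger0_norm // mulr_ge0 ?sinh_ge0// ltW.
Qed.

Lemma radial_coordinate_surj y : alpha + gamma <= y ->
  exists2 u, 0 <= u & y = alpha + gamma * cosh u.
Proof.
move=> ly; have [|u [u0 uy]] := @cosh_surj_ge1 R ((y - alpha) / gamma).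
  by rewrite ler_pdivlMr// mul1r; lra.
by exists u; rewrite // uy mulrC divfK ?gt_eqF//; ring.
Qed.

(** As sinh v - sinh u >= v - u, the increment is at least (alpha + gamma) (v - u), whatever the
    sign of [alpha]. *)
Lemma radial_fun_cosh_increasing u v : 0 <= u -> u < v ->
  gamma * sinh u + alpha * u < gamma * sinh v + alpha * v.
Proof.
move=> u0 uv; have := sinhB_ge (ltW uv).
rewrite -subr_ge0 => /(mulr_ge0 (ltW gamma_gt0)).
by have := mulr_gt0 alpha_gamma_gt0 (etrans (subr_gt0 _ _) uv); lra.
Qed.

Lemma radial_fun_increasing y z : alpha + gamma <= y -> y < z ->
  radial_fun alpha gamma y < radial_fun alpha gamma z.
Proof.
move=> ly yz.
have [u u0 eu] := radial_coordinate_surj ly.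
have [v v0 ev] := radial_coordinate_surj (le_trans ly (ltW yz)).
rewrite eu ev !radial_fun_cosh//; apply: radial_fun_cosh_increasing => //.
rewrite ltNge; apply/negP => vu; move: yz; rewrite eu ev ltNge => /negP; apply.
rewrite lerD2l ler_pM2l//; move: vu; rewrite le_eqVlt => /predU1P[->//|vu].
by rewrite ltW// cosh_lt_ge0.
Qed.

Lemma radial_fun_bij :
  set_bij `[alpha + gamma, +oo[ `[0, +oo[ (radial_fun alpha gamma).
Proof.
have ge0 u : 0 <= u -> 0 <= gamma * sinh u + alpha * u.
  move=> u0; have := sinhB_ge u0; rewrite sinh0 -subr_ge0 => /(mulr_ge0 (ltW gamma_gt0)).
  by have := mulr_ge0 (ltW alpha_gamma_gt0) u0; lra.
split.
- move=> y; rewrite /= !in_itv/= !andbT => /radial_coordinate_surj[u u0 ->].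
  by rewrite radial_fun_cosh// ge0.
- move=> y z /set_mem; rewrite /= in_itv/= andbT => ly /set_mem.
  rewrite /= in_itv/= andbT => lz e.
  have [yz|zy|//] := ltgtP y z.
    by have := radial_fun_increasing ly yz; rewrite e ltxx.
  by have := radial_fun_increasing lz zy; rewrite e ltxx.
- move=> r; rewrite /= in_itv/= andbT => r0.
  pose g u := gamma * sinh u + alpha * u.
  (* From sinh m >= m one gets g m >= (alpha + gamma) m = r, so the intermediate value theorem on
     [0, m] reaches [r]. *)
  pose m := r / (alpha + gamma).
  have m0 : 0 <= m by rewrite divr_ge0// ltW.
  have em : (alpha + gamma) * m = r by rewrite mulrC divfK ?gt_eqF.
  have g0 : g 0 = 0 by rewrite /g sinh0 !mulr0 addr0.
  have gm : r <= g m.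
    have := sinhB_ge m0; rewrite sinh0 -subr_ge0 => /(mulr_ge0 (ltW gamma_gt0)).
    by rewrite /g; lra.
  have [||u] := @IVT R g 0 m r m0.
  + apply: derivable_within_continuous => u _.
    have g' := is_derive_fctD (is_derive_fctZ gamma (is_derive_sinh u))
      (is_derive_fctZ alpha (is_derive_id u 1)).
    exact: (@ex_derive _ _ _ _ _ _ _ g').
  + by rewrite g0 min_l ?max_r ?(le_trans r0)// r0.
  + rewrite in_itv/= => /andP[u0 _] gu; exists (alpha + gamma * cosh u).
      by rewrite /= in_itv/= andbT lerD2l ler_peMr ?cosh_ge1// ltW.
    by rewrite radial_fun_cosh.
Qed.

End RadialFunction.

(** * Half-orbits of a motion whose hyperbolic angle increases *)

Section HyperbolicMotion.
Variables (R : realType) (J : set R) (theta dtheta x : R -> R).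
Variables (alpha gamma : R).
Hypotheses (J_open : open J) (J_itv : is_interval J).
Hypothesis theta' : forall t, J t -> is_derive t 1 theta (dtheta t).
Hypothesis dtheta_gt0 : forall t, J t -> 0 < dtheta t.
Hypothesis gamma_gt0 : 0 < gamma.
Hypothesis xE : forall t, J t -> x t = alpha + gamma * cosh (theta t).

Let theta_incr s t (Js : J s) (Jt : J t) (st : s < t) : theta s < theta t :=
  derive_gt0_increasing J_itv theta' dtheta_gt0 Js Jt st.

Lemma theta_root s t : J s -> J t -> theta s < 0 -> 0 < theta t ->
  exists2 w, s < w < t & theta w = 0.
Proof.
move=> Js Jt s0 t0.
have st : s < t.
  rewrite ltNge; apply/negP; rewrite le_eqVlt => /predU1P[e|ts].
    by move: t0; rewrite e ltNge ltW.
  by have := lt_trans (theta_incr Jt Js ts) s0; rewrite ltNge ltW.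
have [||w] := @IVT R theta s t 0 (ltW st).
- apply: derivable_within_continuous => w; rewrite in_itv/= => /(J_itv Js Jt) Jw.
  exact: (@ex_derive _ _ _ _ _ _ _ (theta' Jw)).
- by rewrite ge_min le_max (ltW s0) (ltW t0) orbT.
- rewrite in_itv/= => /andP[]; rewrite !le_eqVlt.
  move=> /predU1P[sw|sw]; first by move=> _ e; move: s0; rewrite sw e ltxx.
  move=> /predU1P[wt|wt] e; first by move: t0; rewrite -wt e ltxx.
  by exists w => //; rewrite sw.
Qed.

(** On a half-orbit both [sigma * theta] and [x], hence cosh theta, increase with sigma times the
    time. If [sigma * theta] were negative at [t], it would be nonpositive at a second point of [S];
    but [cosh] decreases on nonpositive arguments. *)
Lemma half_orbit_phase sigma S t : half_orbit J x sigma S -> S t ->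
  [/\ J t, 0 <= sigma * theta t & sigma = 1 \/ sigma = -1].
Proof.
move=> [SJ Si [s1 [s2 [Ss1 Ss2 s12]]] H] St.
have [u Su ut] : exists2 u, S u & u != t.
  have [e|e] := eqVneq s1 t; last by exists s1.
  by exists s2; rewrite // -e gt_eqF.
have sgn : sigma = 1 \/ sigma = -1 by case: H => -[]; [left|right].
have [Jt Ju] := (SJ _ St, SJ _ Su).
split => //; rewrite leNgt; apply/negP => t0.
pose f s := sigma * theta s.
have coshf s : cosh (f s) = cosh (theta s).
  by rewrite /f; case: sgn => ->; rewrite ?mul1r ?mulN1r ?coshN.
have f_incr s w : S s -> S w -> 0 < sigma * (w - s) -> f s < f w.
  move=> /SJ Js /SJ Jw; rewrite /f; case: sgn => ->.
    by rewrite !mul1r subr_gt0; exact: theta_incr.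
  by rewrite !mulN1r oppr_gt0 subr_lt0 ltrN2; exact: theta_incr.
have cosh_incr s w : S s -> S w -> 0 < sigma * (w - s) ->
    cosh (f s) < cosh (f w).
  move=> Ss Sw sw; rewrite !coshf -(ltr_pM2l gamma_gt0) -(ltrD2l alpha).
  rewrite -!xE; try exact: SJ.
  case: H => -[es mono]; move: sw; rewrite es.
    by rewrite mul1r subr_gt0; exact: mono.
  by rewrite mulN1r oppr_gt0 subr_lt0; exact: mono.
(* If [f u] is positive, [theta] vanishes between [t] and [u], at a point that lies in the interval
   [S]. *)
have [w [Sw w0 tw]] : exists w, [/\ S w, f w <= 0 & w != t].
  have [u0|u0] := leP (f u) 0; first by exists u.
  suff [w [Sw w0]] : exists w, S w /\ theta w = 0.
    exists w; rewrite /f w0 mulr0; split => //.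
    by apply: contraTneq t0 => <-; rewrite w0 mulr0 ltxx.
  case: sgn => es; move: t0 u0; rewrite /f es ?mul1r ?mulN1r ?oppr_lt0 ?oppr_gt0.
    move=> t0 u0; have [w /andP[tw wu] w0] := theta_root Jt Ju t0 u0.
    by exists w; split => //; apply: (Si _ _ St Su); rewrite !ltW.
  move=> t0 u0; have [w /andP[uw wt] w0] := theta_root Ju Jt u0 t0.
  by exists w; split => //; apply: (Si _ _ Su St); rewrite !ltW.
have : 0 < sigma * (w - t) \/ 0 < sigma * (t - w).
  move: tw; rewrite neq_lt => /orP[wt|wt]; case: sgn => ->.
  - by right; lra.
  - by left; lra.
  - by left; lra.
  - by right; lra.
case=> tw'.
- have := cosh_incr _ _ St Sw tw'; have fw := f_incr _ _ St Sw tw'.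
  rewrite ltNge -(coshN (f w)) -(coshN (f t)) => /negP; apply.
  by rewrite ltW// cosh_lt_ge0 ?oppr_ge0 ?ltrN2.
- have := cosh_incr _ _ Sw St tw'; have fw := f_incr _ _ Sw St tw'.
  rewrite ltNge -(coshN (f w)) -(coshN (f t)) => /negP; apply.
  by rewrite ltW// cosh_lt_ge0 ?oppr_ge0 ?ltrN2// ltW.
Qed.

Lemma half_orbit_ge0 t : J t -> 0 <= theta t ->
  half_orbit J x 1 (J `&` [set s | t <= s]).
Proof.
move=> Jt t0; split => //.
- move=> s w [Js /= ts] [Jw /= tw] z /andP[sz zw]; split.
    by apply: (J_itv Js Jw); rewrite sz.
  exact: le_trans ts sz.
(* Openness of [J] supplies a later time, so that the half-orbit is nondegenerate. *)
- have [e /= e0 Je] : nbhs t J by exact: open_nbhs_nbhs.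
  exists t, (t + e / 2); split; rewrite /= ?ltrDl ?divr_gt0//.
  split; rewrite /= ?lerDl ?divr_ge0 ?ltW//; apply: Je => /=.
  by rewrite opprD addNKr normrN gtr0_norm ?divr_gt0// gtr_pMr// invf_lt1 ?ltr1n.
- left; split => // s w [Js /= ts] [Jw /= tw] sw.
  rewrite !xE// ltrD2l ltr_pM2l// cosh_lt_ge0 ?theta_incr//.
  move: ts; rewrite le_eqVlt => /predU1P[<-//|ts].
  by rewrite (le_trans t0)// ltW// theta_incr.
Qed.

Lemma half_orbit_le0 t : J t -> theta t <= 0 ->
  half_orbit J x (-1) (J `&` [set s | s <= t]).
Proof.
move=> Jt t0; split => //.
- move=> s w [Js /= ts] [Jw /= tw] z /andP[sz zw]; split.
    by apply: (J_itv Js Jw); rewrite sz.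
  exact: le_trans zw tw.
- have [e /= e0 Je] : nbhs t J by exact: open_nbhs_nbhs.
  exists (t - e / 2), t; split; rewrite /= ?gtrDl ?oppr_lt0 ?divr_gt0//.
  split; rewrite /= ?gerDl ?oppr_le0 ?divr_ge0 ?ltW//; apply: Je => /=.
  by rewrite opprB addrCA subrr addr0 gtr0_norm ?divr_gt0// gtr_pMr// invf_lt1 ?ltr1n.
- right; split => // s w [Js /= ts] [Jw /= tw] sw.
  rewrite !xE// ltrD2l ltr_pM2l// -coshN -(coshN (theta s)).
  rewrite cosh_lt_ge0 ?ltrN2 ?oppr_ge0 ?theta_incr//.
  move: tw; rewrite le_eqVlt => /predU1P[->//|tw].
  by rewrite (le_trans _ t0)// ltW// theta_incr.
Qed.

Lemma half_orbit_cover t : J t -> exists sigma S, half_orbit J x sigma S /\ S t.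
Proof.
move=> Jt; have [t0|t0] := leP 0 (theta t).
  by exists 1, (J `&` [set s | t <= s]); split; [exact: half_orbit_ge0|split => /=].
exists (-1), (J `&` [set s | s <= t]).
by split; [exact/half_orbit_le0/ltW|split => /=].
Qed.

(** On a half-orbit, u = sigma theta is the nonnegative angle with x = alpha + gamma cosh u. The
    right-hand side is odd in theta, so the sign passes to the left. *)
Lemma radial_law_cosh (E tau : R) :
  (forall t, J t ->
    2 * Num.sqrt E * (t - tau) = gamma * sinh (theta t) + alpha * theta t) ->
  radial_law J x E alpha gamma tau.
Proof.
move=> H sigma S oS t St; have [Jt st0 sgn] := half_orbit_phase oS St.
have -> : x t = alpha + gamma * cosh (sigma * theta t).
  by rewrite xE//; case: sgn => ->; rewrite ?mul1r ?mulN1r ?coshN.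
rewrite radial_fun_cosh// H//.
by case: sgn => ->; rewrite ?mul1r ?mulN1r ?sinhN; ring.
Qed.

Lemma angular_law_cosh (Q : R -> R) (a r phi : R) :
  (forall t, J t -> Q t = a + r * cosh (theta t + phi)) ->
  angular_law J x Q alpha gamma a r phi.
Proof.
move=> H sigma S oS t St; have [Jt st0 sgn] := half_orbit_phase oS St.
have xs : gamma^-1 * (x t - alpha) = cosh (sigma * theta t).
  rewrite xE// (_ : alpha + _ - alpha = gamma * cosh (theta t)); last by ring.
  rewrite mulKf ?gt_eqF//.
  by case: sgn => ->; rewrite ?mul1r ?mulN1r ?coshN.
(* Here X = sigma theta, and [cosh] is even, so the sign may multiply the whole argument theta +
   phi. *)
have Qs : Q t = a + r * cosh (sigma * theta t + sigma * phi).
  rewrite H// -mulrDr.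
  by case: sgn => ->; rewrite ?mul1r ?mulN1r ?coshN.
move=> /=; rewrite xs coshK//; split => //.
rewrite [_ / gamma]mulrC xs distrC cosh_sqrB1 ger0_norm ?sqr_ge0//.
rewrite sqrtr_sqr ger0_norm ?sinh_ge0// Qs coshD -xs.
by ring.
Qed.

End HyperbolicMotion.

(** * The linear system Y' = P, P' = Y in the angle variable *)

Section HyperbolicOscillator.
Variables (R : realType) (J : set R) (theta dtheta Y P : R -> R).
Hypothesis J_itv : is_interval J.
Hypothesis theta' : forall t, J t -> is_derive t 1 theta (dtheta t).
Hypothesis Y' : forall t, J t -> is_derive t 1 Y (dtheta t * P t).
Hypothesis P' : forall t, J t -> is_derive t 1 P (dtheta t * Y t).

(** Both expressions are the components of (Y, P) after the hyperbolic rotation by - theta, which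
    undoes the flow; their derivatives cancel. *)
Lemma hyperbolic_oscillator_constants s t : J s -> J t ->
  Y s * cosh (theta s) - P s * sinh (theta s) =
    Y t * cosh (theta t) - P t * sinh (theta t) /\
  P s * cosh (theta s) - Y s * sinh (theta s) =
    P t * cosh (theta t) - Y t * sinh (theta t).
Proof.
move=> Js Jt; split.
- pose f t := Y t * cosh (theta t) - P t * sinh (theta t).
  apply: (derive0_constant (f := f) J_itv) => // w Jw.
  have := is_deriveB (is_derive_fctM (Y' Jw) (is_derive_fct_cosh (theta' Jw)))
    (is_derive_fctM (P' Jw) (is_derive_fct_sinh (theta' Jw))).
  by move/is_derive_eq; apply; ring.
- pose f t := P t * cosh (theta t) - Y t * sinh (theta t).
  apply: (derive0_constant (f := f) J_itv) => // w Jw.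
  have := is_deriveB (is_derive_fctM (P' Jw) (is_derive_fct_cosh (theta' Jw)))
    (is_derive_fctM (Y' Jw) (is_derive_fct_sinh (theta' Jw))).
  by move/is_derive_eq; apply; ring.
Qed.

Lemma hyperbolic_oscillator_solution t0 (A B : R) : J t0 ->
  A = Y t0 * cosh (theta t0) - P t0 * sinh (theta t0) ->
  B = P t0 * cosh (theta t0) - Y t0 * sinh (theta t0) ->
  forall t, J t -> Y t = A * cosh (theta t) + B * sinh (theta t).
Proof.
move=> Jt0 eA eB t Jt.
have [hA hB] := hyperbolic_oscillator_constants Jt0 Jt.
rewrite eA eB hA hB -[LHS]mulr1 -(cosh_sqrB_sinh_sqr (theta t)).
by ring.
Qed.

End HyperbolicOscillator.

(** * Existence of the hyperbolic angle *)

Section HyperbolicPhase.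
Variables (R : realType) (J : set R) (X S dtheta : R -> R) (gamma : R).
Hypothesis X' : forall t, J t -> is_derive t 1 X (dtheta t * S t).
Hypothesis S' : forall t, J t -> is_derive t 1 S (dtheta t * X t).
Hypothesis gamma_gt0 : 0 < gamma.
Hypothesis X_gt0 : forall t, J t -> 0 < X t.
Hypothesis XS : forall t, J t -> X t ^+ 2 - S t ^+ 2 = gamma ^+ 2.

(** The angle is read off from gamma exp theta = X + S. Since (X + S)' = dtheta (X + S), its
    logarithmic derivative is [dtheta]. *)
Lemma hyperbolic_phase : exists theta : R -> R, forall t, J t ->
  [/\ is_derive t 1 theta (dtheta t), X t = gamma * cosh (theta t) &
      S t = gamma * sinh (theta t)].
Proof.
exists (fun t => ln (gamma^-1 * (X t + S t))) => t Jt.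
have g0 : gamma != 0 by rewrite gt_eqF.
have XSt := XS Jt; have Xt := X_gt0 Jt.
(* Otherwise S <= - X < 0 and X^2 <= S^2, against gamma > 0. *)
have w0 : 0 < X t + S t.
  rewrite ltNge; apply/negP => le0.
  have : X t ^+ 2 <= S t ^+ 2 by nra.
  by have := exprn_gt0 2 gamma_gt0; lra.
have gw0 : 0 < gamma^-1 * (X t + S t) by rewrite mulr_gt0 ?invr_gt0.
split.
- have w' := is_derive_fctZ gamma^-1 (is_derive_fctD (X' Jt) (S' Jt)).
  have := is_derive_fct_ln (f := fun s => gamma^-1 * (X s + S s)) gw0 w'.
  by move/is_derive_eq; apply; field; rewrite g0 gt_eqF.
- rewrite /cosh expRN lnK ?posrE// invfM invrK.
  (* The factorization (X + S) (X - S) = gamma^2 gives exp (- theta). *)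
  have -> : (X t + S t)^-1 = (X t - S t) / gamma ^+ 2.
    by rewrite -XSt; field; rewrite XSt expf_neq0//= gt_eqF.
  by field.
- rewrite /sinh expRN lnK ?posrE// invfM invrK.
  have -> : (X t + S t)^-1 = (X t - S t) / gamma ^+ 2.
    by rewrite -XSt; field; rewrite XSt expf_neq0//= gt_eqF.
  by field.
Qed.

End HyperbolicPhase.

(** * Inequalities and partial derivatives for the Hamiltonian *)

Section Hamiltonian.
Variables (R : realType) (n : nat) (kappa c : R) (b : 'I_n -> R).
Hypothesis kappa_gt0 : 0 < kappa.
Implicit Types (u v p q : 'rV[R]_n) (i j : 'I_n).

Lemma sum_delta (F : 'I_n -> R) i : \sum_j F j * (j == i)%:R = F i.
Proof.
rewrite (bigD1 i)//= eqxx mulr1 big1 ?addr0// => j /negbTE ->.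
by rewrite mulr0.
Qed.

Lemma dot_ge0 u : 0 <= dot u u.
Proof. by apply: sumr_ge0 => j _; rewrite -expr2 sqr_ge0. Qed.

Lemma dot_Cauchy_Schwarz u v : dot u v ^+ 2 <= dot v v * dot u u.
Proof.
have [v0|v0] := eqVneq (dot v v) 0.
  rewrite v0 mul0r {1}/dot big1 ?expr0n// => j _.
  have /eqP : v 0 j * v 0 j = 0.
    apply: (psumr_eq0P _ v0) => // k _.
    by rewrite -expr2 sqr_ge0.
  by rewrite mulf_eq0 orbb => /eqP ->; rewrite mulr0.
have vp : 0 < dot v v by rewrite lt0r v0 dot_ge0.
(* This is the squared length of the part of [u] orthogonal to [v], scaled by v.v to avoid
   division. *)
have : 0 <= \sum_j (dot v v * u 0 j - dot u v * v 0 j) ^+ 2.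
  by apply: sumr_ge0 => j _; exact: sqr_ge0.
suff -> : \sum_j (dot v v * u 0 j - dot u v * v 0 j) ^+ 2 =
    dot v v * (dot v v * dot u u - dot u v ^+ 2).
  by rewrite pmulr_rge0// subr_ge0.
have sqrB a r : \sum_j (a * u 0 j - r * v 0 j) ^+ 2 =
    a ^+ 2 * dot u u - 2 * a * r * dot u v + r ^+ 2 * dot v v.
  rewrite /dot !mulr_sumr -sumrB -big_split/=.
  by apply: eq_bigr => j _; ring.
by rewrite sqrB; ring.
Qed.

Lemma integralC_ge0 p q : (forall j, 0 <= b j) -> 0 <= integralC b p q.
Proof.
move=> b0; rewrite /integralC mulrDr addrAC addr_ge0//.
  by rewrite subr_ge0 dot_Cauchy_Schwarz.
rewrite mulr_ge0 ?dot_ge0// sumr_ge0// => j _.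
by rewrite mulr_ge0// invr_ge0 sqr_ge0.
Qed.

(** The difference quotients coincide. Restricting to a line makes the one-variable rules available
    for partial derivatives. *)
Lemma derive_line (f : 'rV[R]_n -> R) u v :
  'D_v f u = 'D_1 (fun h : R => f (h *: v + u)) 0.
Proof.
rewrite /derive; set F := (X in lim (X @ _)); set G := (X in _ = lim (X @ _)).
suff -> : F = G by [].
by apply/funext => h; rewrite /F /G/= addr0 scale0r add0r [h *: 1]mulr1.
Qed.

Lemma is_derive_line_coord i u j :
  is_derive (0 : R) 1 (fun h : R => (h *: delta_mx 0 i + u) 0 j) (j == i)%:R.
Proof.
have := is_deriveD (is_derive_fctM (is_derive_id (0 : R) 1)
  (is_derive_cst ((j == i)%:R : R) (0 : R) 1)) (is_derive_cst (u 0 j) (0 : R) 1).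
move/is_derive_eq => /(_ (j == i)%:R); rewrite mul1r mulr0 !addr0 => /(_ erefl).
by congr is_derive; apply/funext => h; rewrite !mxE.
Qed.

Lemma line0 i u : 0 *: delta_mx 0 i + u = u.
Proof. by rewrite scale0r add0r. Qed.

Lemma is_derive_line_dot i u :
  is_derive (0 : R) 1
    (fun h : R => dot (h *: delta_mx 0 i + u) (h *: delta_mx 0 i + u))
    (2 * u 0 i).
Proof.
have := is_derive_fct_sum (fun j => is_derive_fctM (is_derive_line_coord i u j)
  (is_derive_line_coord i u j)).
move/is_derive_eq; apply; rewrite line0 -(sum_delta (fun j => 2 * u 0 j) i).
by apply: eq_bigr => j _; ring.
Qed.

Lemma is_derive_line_centrifugal i u : (forall j, b j = 0 \/ u 0 j != 0) ->
  is_derive (0 : R) 1 (fun h : R => centrifugal b (h *: delta_mx 0 i + u))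
    (- (2 * b i * u 0 i ^- 3)).
Proof.
move=> bu.
have bu' j : b j = 0 \/ (0 *: delta_mx 0 i + u) 0 j != 0 by rewrite line0.
have := is_derive_fct_sum (fun j =>
  is_derive_inv_sqr (bu' j) (is_derive_line_coord i u j)).
move/is_derive_eq; apply; rewrite line0.
rewrite -(sum_delta (fun j => - (2 * b j * u 0 j ^- 3)) i).
by apply: eq_bigr => j _; rewrite mulNr.
Qed.

Let x_neq0 u : kappa + dot u u != 0.
Proof. by rewrite gt_eqF// ltr_wpDr ?dot_ge0. Qed.

Lemma derive_hamiltonian_p i p q :
  'D_(delta_mx 0 i) (fun p' => hamiltonian kappa c b p' q) p =
  p 0 i / (kappa + dot q q).
Proof.
rewrite derive_line; apply: derive_val.
have := is_derive_fctM (is_derive_fctD (is_derive_fctD (is_derive_line_dot i p)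
  (is_derive_cst (- c) (0 : R) 1)) (is_derive_cst (centrifugal b q) (0 : R) 1))
  (is_derive_cst (2 * (kappa + dot q q))^-1 (0 : R) 1).
by move/is_derive_eq; apply; rewrite mulr0 !addr0 /cst; field.
Qed.

(** Differentiating the denominator reproduces H itself, so once H is known to be constant the force
    is, up to the factor 1 / x, linear in q_i plus an inverse cube. *)
Lemma derive_hamiltonian_q i p q : (forall j, b j = 0 \/ q 0 j != 0) ->
  'D_(delta_mx 0 i) (fun q' => hamiltonian kappa c b p q') q =
  - ((b i * q 0 i ^- 3 + 2 * hamiltonian kappa c b p q * q 0 i) /
     (kappa + dot q q)).
Proof.
move=> bq; rewrite derive_line; apply: derive_val.
have x2 : 2 * (kappa + dot (0 *: delta_mx 0 i + q) (0 *: delta_mx 0 i + q)) != 0.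
  by rewrite mulf_neq0// x_neq0.
have := is_derive_fctM (is_derive_fctD (is_derive_cst (dot p p - c) (0 : R) 1)
    (is_derive_line_centrifugal i bq))
  (is_derive_fctV (f := fun h : R => 2 *
     (kappa + dot (h *: delta_mx 0 i + q) (h *: delta_mx 0 i + q))) x2
   (is_derive_fctZ 2
     (is_derive_fctD (is_derive_cst kappa (0 : R) 1) (is_derive_line_dot i q)))).
move/is_derive_eq; apply; rewrite /hamiltonian line0 /cst.
by set y := q 0 i ^- 3; have := x_neq0 q; move: (kappa + _) => X X0; field.
Qed.

End Hamiltonian.

(** * First integrals along a solution *)

Section Flow.
Variables (R : realType) (n : nat) (kappa c : R) (b : 'I_n -> R).
Variables (J : set R) (q p : R -> 'rV[R]_n) (t0 : R).
Hypothesis kappa_gt0 : 0 < kappa.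
Hypothesis J_itv : is_interval J.
Hypothesis Jt0 : J t0.
Hypothesis bq : forall t, J t -> forall j, b j = 0 \/ q t 0 j != 0.
Hypothesis flow : hamilton_solution (hamiltonian kappa c b) J q p.

Let x t := kappa + dot (q t) (q t).
Let h t := 2 * hamiltonian kappa c b (p t) (q t).
Let s t := dot (p t) (q t).
Let M t := dot (p t) (p t) + centrifugal b (q t).
Let E := 2 * hamiltonian kappa c b (p t0) (q t0).

Lemma x_gt0 t : 0 < x t.
Proof. by rewrite ltr_wpDr ?dot_ge0. Qed.

Let x_neq0 t : x t != 0. Proof. by rewrite gt_eqF ?x_gt0. Qed.

Lemma is_derive_q t : J t -> forall i,
  is_derive t 1 (fun r => q r 0 i) (p t 0 i / x t).
Proof.
by move=> Jt i; have [q' _] := flow Jt i; rewrite derive_hamiltonian_p in q'.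
Qed.

Lemma is_derive_p t : J t -> forall i,
  is_derive t 1 (fun r => p r 0 i) ((b i * q t 0 i ^- 3 + h t * q t 0 i) / x t).
Proof.
move=> Jt i; have [_] := flow Jt i; rewrite derive_hamiltonian_q//; last exact: bq.
by rewrite opprK.
Qed.

Lemma is_derive_x t : J t -> is_derive t 1 x (2 * s t / x t).
Proof.
move=> Jt; have q' := is_derive_q Jt.
have := is_derive_fctD (is_derive_cst kappa t 1)
  (is_derive_fct_sum (fun i => is_derive_fctM (q' i) (q' i))).
move/is_derive_eq; apply; rewrite add0r /s /dot mulr_sumr mulr_suml.
by apply: eq_bigr => i _; field.
Qed.

(** The inverse-cube force cancels against the derivative of b_i / q_i^2, leaving [h] times the
    derivative of q_i^2. *)
Lemma is_derive_momentum_sqr t : J t -> forall i,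
  is_derive t 1 (fun r => p r 0 i ^+ 2 + b i * q r 0 i ^- 2)
    (h t * (2 * (p t 0 i * q t 0 i) / x t)).
Proof.
move=> Jt i.
have := is_derive_fctD (is_derive_fct_sqr (is_derive_p Jt i))
  (is_derive_inv_sqr (bq Jt i) (is_derive_q Jt i)).
by move/is_derive_eq; apply; set y := q t 0 i ^- 3; field.
Qed.

Lemma is_derive_M t : J t -> is_derive t 1 M (h t * (2 * s t / x t)).
Proof.
move=> Jt; have := is_derive_fct_sum (is_derive_momentum_sqr Jt).
rewrite -mulr_sumr -mulr_suml -mulr_sumr.
by congr is_derive; apply/funext => r; rewrite big_split.
Qed.

Lemma M_energy t : M t = h t * x t + c.
Proof. by rewrite /h /hamiltonian -/(x t) /M; field. Qed.

(** Since h = (M - c) / x and M' = h x', the quotient rule gives h' = 0. *)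
Lemma energy_constant t : J t -> h t = E.
Proof.
move=> Jt; apply: (derive0_constant (f := h) J_itv _ Jt Jt0) => {Jt} {}t Jt.
have := is_derive_fctM (is_derive_fctD (is_derive_M Jt) (is_derive_cst (- c) t 1))
  (is_derive_fctV (x_neq0 t) (is_derive_x Jt)).
rewrite (_ : (fun _ => _) = h); last first.
  by apply/funext => r; rewrite M_energy /cst; field.
by move/is_derive_eq; apply; rewrite M_energy /cst; field.
Qed.

Lemma M_affine t : J t -> M t = E * x t + c.
Proof. by move=> Jt; rewrite M_energy energy_constant. Qed.

Lemma is_derive_pq t : J t -> forall i,
  is_derive t 1 (fun r => p r 0 i * q r 0 i)
    ((p t 0 i ^+ 2 + b i * q t 0 i ^- 2 + E * q t 0 i ^+ 2) / x t).
Proof.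
move=> Jt i.
have := is_derive_fctM (is_derive_p Jt i) (is_derive_q Jt i).
move/is_derive_eq; apply; rewrite energy_constant//.
(* This also holds at q_i = 0, where the inverse of zero is zero. *)
have -> : q t 0 i ^- 2 = q t 0 i ^- 3 * q t 0 i.
  have [->|q0] := eqVneq (q t 0 i) 0; last by field.
  by rewrite mulr0 expr0n invr0.
by set y := q t 0 i ^- 3; field.
Qed.

Lemma is_derive_dot_pq t : J t ->
  is_derive t 1 s ((M t + E * dot (q t) (q t)) / x t).
Proof.
move=> Jt; have := is_derive_fct_sum (is_derive_pq Jt).
move/is_derive_eq; apply; rewrite -mulr_suml; congr (_ / _).
rewrite /M /centrifugal /dot mulr_sumr -!big_split/=.
by apply: eq_bigr => i _; rewrite !expr2.
Qed.

(** Written as C = (x - kappa) M - s^2, the first term has derivative x' (M + E q^2), which equals 2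
    s s' because x' = 2 s / x. *)
Lemma integralC_constant t : J t ->
  integralC b (p t) (q t) = integralC b (p t0) (q t0).
Proof.
move=> Jt.
apply: (derive0_constant (f := fun t => integralC b (p t) (q t)) J_itv _ Jt Jt0).
move=> {Jt} {}t Jt.
have := is_derive_fctD (is_derive_fctM
    (is_derive_fctD (is_derive_cst (- kappa) t 1) (is_derive_x Jt)) (is_derive_M Jt))
  (is_derive_fctZ (-1) (is_derive_fct_sqr (is_derive_dot_pq Jt))).
rewrite (_ : (fun _ => _) = (fun t => integralC b (p t) (q t))); last first.
  by apply/funext => r; rewrite /cst /x addKr mulN1r.
move/is_derive_eq; apply; rewrite /cst energy_constant// /x addKr -/(x t).
by field.
Qed.

Lemma integralI_constant t : J t -> forall i,
  integralI kappa c b i (p t) (q t) = integralI kappa c b i (p t0) (q t0).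
Proof.
move=> Jt i.
pose f r := p r 0 i ^+ 2 + b i * q r 0 i ^- 2 + - E * q r 0 i ^+ 2.
have fE r : J r -> integralI kappa c b i (p r) (q r) = f r.
  by move=> Jr; rewrite /integralI -/(h r) energy_constant// /f; ring.
rewrite !fE//; apply: (derive0_constant (f := f) J_itv _ Jt Jt0) => {Jt} {}t Jt.
have := is_derive_fctD (is_derive_momentum_sqr Jt i)
  (is_derive_fctZ (- E) (is_derive_fct_sqr (is_derive_q Jt i))).
by move/is_derive_eq; apply; rewrite energy_constant//; field.
Qed.

(** * Radial and coordinate hyperbolas at positive energy *)

Hypothesis E_gt0 : 0 < E.
Hypothesis c_gt0 : 0 < c.
Hypothesis b_ge0 : forall j, 0 <= b j.

Let C := integralC b (p t0) (q t0).
Let I_ i := integralI kappa c b i (p t0) (q t0).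
Let alpha := (kappa - c / E) / 2.
Let gamma := Num.sqrt ((kappa + c / E) ^+ 2 / 4 + C / E).
Let alpha_ i := - (I_ i / (2 * E)).
Let gamma_ i := Num.sqrt (alpha_ i ^+ 2 + b i / E).

Let E_neq0 : E != 0. Proof. by rewrite gt_eqF. Qed.

Let C_ge0 : 0 <= C. Proof. exact: integralC_ge0. Qed.

Let cE_gt0 : 0 < c / E. Proof. exact: divr_gt0. Qed.

Lemma gamma_sqr : gamma ^+ 2 = (kappa + c / E) ^+ 2 / 4 + C / E.
Proof.
by rewrite sqr_sqrtr// addr_ge0 ?divr_ge0 ?sqr_ge0// ltW.
Qed.

(** This follows from C >= 0, and it yields both gamma > 0 and alpha + gamma >= kappa > 0. *)
Lemma gamma_ge : (kappa + c / E) / 2 <= gamma.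
Proof.
have : 0 <= C / E by rewrite divr_ge0// ltW.
have := gamma_sqr; have : 0 <= gamma by exact: sqrtr_ge0.
by have := cE_gt0; nra.
Qed.

Lemma gamma_gt0 : 0 < gamma.
Proof. by have := gamma_ge; have := cE_gt0; have := kappa_gt0; lra. Qed.

Lemma alpha_gamma_gt0 : 0 < alpha + gamma.
Proof. by have := gamma_ge; have := kappa_gt0; rewrite /alpha; lra. Qed.

Lemma x_alpha_gt0 t : 0 < x t - alpha.
Proof.
have := dot_ge0 (q t); have := cE_gt0; have := kappa_gt0.
by rewrite /x /alpha; lra.
Qed.

Let S t := s t / Num.sqrt E.
Let dtheta t := 2 * Num.sqrt E / x t.

Let sqrtE_neq0 : Num.sqrt E != 0. Proof. by rewrite gt_eqF ?sqrtr_gt0. Qed.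

Let sqrE : Num.sqrt E ^+ 2 = E. Proof. by rewrite sqr_sqrtr// ltW. Qed.

Let sqrtEV : (Num.sqrt E)^-1 = Num.sqrt E / E.
Proof. by rewrite -[X in _ / X]sqrE expr2 invfM mulrA mulfV// mul1r. Qed.

(** By [M_affine], C / E = (x - kappa) (x + c / E) - S^2. Completing the square puts the centre at
    [alpha], the midpoint of the roots kappa and - c / E. *)
Lemma radial_momentum t : J t ->
  (x t - alpha) ^+ 2 - S t ^+ 2 = gamma ^+ 2.
Proof.
move=> Jt; rewrite gamma_sqr /S expr_div_n sqrE.
have -> : C = (x t - kappa) * (E * x t + c) - s t ^+ 2.
  rewrite /C -(integralC_constant Jt) -M_affine//.
  by rewrite (_ : x t - kappa = dot (q t) (q t)) // /x; ring.
by rewrite /alpha; field.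
Qed.

Lemma is_derive_x_alpha t : J t ->
  is_derive t 1 (fun r => x r - alpha) (dtheta t * S t).
Proof.
move=> Jt; have := is_derive_fctD (is_derive_x Jt) (is_derive_cst (- alpha) t 1).
by move/is_derive_eq; apply; rewrite /S /dtheta; field; rewrite sqrtE_neq0 x_neq0.
Qed.

Lemma is_derive_S t : J t -> is_derive t 1 S (dtheta t * (x t - alpha)).
Proof.
move=> Jt; have := is_derive_fctM (is_derive_dot_pq Jt) (is_derive_cst (Num.sqrt E)^-1 t 1).
move/is_derive_eq; apply; rewrite M_affine// (_ : dot _ _ = x t - kappa); last first.
  by rewrite /x; ring.
rewrite /alpha /dtheta /cst mulr0 addr0.
by rewrite sqrtEV; field; rewrite E_neq0 x_neq0.
Qed.

(** The I_i add up to M - E q^2, which is E kappa + c because M is affine in x. *)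
Lemma sum_alpha_ : \sum_i alpha_ i + kappa = alpha.
Proof.
rewrite sumrN -mulr_suml.
have -> : \sum_i I_ i = M t0 - E * (x t0 - kappa).
  rewrite /M /x [kappa + _]addrC addrK /dot /centrifugal mulr_sumr -sumrN -!big_split/=.
  by apply: eq_bigr => i _; rewrite /I_ /integralI -/E; ring.
by rewrite M_affine// /alpha; field.
Qed.

Let P i t := p t 0 i * q t 0 i / Num.sqrt E.
Let Y i t := q t 0 i ^+ 2 - alpha_ i.

(** Inserting I_i reverses the sign of E q_i^2. All terms become nonnegative, and the numerator is x
    times the derivative of p_i q_i. *)
Lemma Y_eq i t : J t ->
  Y i t = (p t 0 i ^+ 2 + b i * q t 0 i ^- 2 + E * q t 0 i ^+ 2) / (2 * E).
Proof.
move=> Jt; rewrite /Y /alpha_ /I_ -(integralI_constant Jt) /integralI -/(h t).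
by rewrite energy_constant//; set y := q t 0 i ^- 2; field.
Qed.

Lemma is_derive_Y i t : J t -> is_derive t 1 (Y i) (dtheta t * P i t).
Proof.
move=> Jt; have := is_derive_fctD (is_derive_fct_sqr (is_derive_q Jt i))
  (is_derive_cst (- alpha_ i) t 1).
by move/is_derive_eq; apply; rewrite /P /dtheta; field; rewrite sqrtE_neq0 x_neq0.
Qed.

Lemma is_derive_P i t : J t -> is_derive t 1 (P i) (dtheta t * Y i t).
Proof.
move=> Jt; have := is_derive_fctM (is_derive_pq Jt i) (is_derive_cst (Num.sqrt E)^-1 t 1).
move/is_derive_eq; apply; rewrite Y_eq// /dtheta /cst mulr0 addr0 sqrtEV.
by set y := q t 0 i ^- 2; field; rewrite E_neq0 x_neq0.
Qed.

Lemma Y_ge0 i t : J t -> 0 <= Y i t.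
Proof.
move=> Jt; rewrite Y_eq//; have E0 := ltW E_gt0.
apply: divr_ge0; last by rewrite mulr_ge0.
have cf_ge0 : 0 <= b i * q t 0 i ^- 2 by rewrite mulr_ge0// invr_ge0 sqr_ge0.
by rewrite !addr_ge0 ?sqr_ge0// mulr_ge0 ?sqr_ge0.
Qed.

Lemma gamma_i_sqr i : gamma_ i ^+ 2 = alpha_ i ^+ 2 + b i / E.
Proof. by rewrite sqr_sqrtr// addr_ge0 ?sqr_ge0// divr_ge0// ltW. Qed.

Lemma Y_sqrB i t : J t -> Y i t ^+ 2 - P i t ^+ 2 = gamma_ i ^+ 2.
Proof.
move=> Jt; rewrite gamma_i_sqr /P expr_div_n sqrE /Y.
have -> : alpha_ i =
    - ((p t 0 i ^+ 2 - E * q t 0 i ^+ 2 + b i * q t 0 i ^- 2) / (2 * E)).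
  by rewrite /alpha_ /I_ -(integralI_constant Jt) /integralI -/(h t) energy_constant.
(* The product of b_i / q_i^2 and q_i^2 must give back b_i, hence the split into b_i = 0 and q_i
   nonzero. *)
have [b0|q0] := bq Jt i; first by rewrite b0; set y := _ ^- 2; field.
by field; rewrite q0 E_neq0.
Qed.

(** * The radial and angular laws of the flow *)

Hypothesis J_open : open J.

Let dtheta_gt0 t : J t -> 0 < dtheta t.
Proof. by move=> _; rewrite divr_gt0 ?x_gt0// mulr_gt0// sqrtr_gt0. Qed.

Lemma flow_phase : exists theta : R -> R, forall t, J t ->
  [/\ is_derive t 1 theta (dtheta t), x t - alpha = gamma * cosh (theta t) &
      S t = gamma * sinh (theta t)].
Proof.
exact: (hyperbolic_phase is_derive_x_alpha is_derive_S gamma_gt0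
  (fun t _ => x_alpha_gt0 t) radial_momentum).
Qed.

Lemma x_ge t : J t -> alpha + gamma <= x t.
Proof.
move=> Jt; have [theta /(_ _ Jt)[_ xE _]] := flow_phase.
by rewrite addrC -lerBrDr xE ler_peMr ?cosh_ge1// ltW ?gamma_gt0.
Qed.

Lemma flow_half_orbit_cover t : J t ->
  exists sigma T, half_orbit J x sigma T /\ T t.
Proof.
move=> Jt; have [theta thetaP] := flow_phase.
have theta' r : J r -> is_derive r 1 theta (dtheta r) by case/thetaP.
have xE r : J r -> x r = alpha + gamma * cosh (theta r).
  by case/thetaP => _ <- _; rewrite addrC subrK.
exact: half_orbit_cover theta' dtheta_gt0 gamma_gt0 xE _ Jt.
Qed.

Lemma flow_radial_law : exists tau, radial_law J x E alpha gamma tau.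
Proof.
have [theta thetaP] := flow_phase.
have theta' r : J r -> is_derive r 1 theta (dtheta r) by case/thetaP.
have xE r : J r -> x r = alpha + gamma * cosh (theta r).
  by case/thetaP => _ <- _; rewrite addrC subrK.
(* Its derivative is x theta' - 2 sqrt E = 0; its constant value is - 2 sqrt E tau. *)
pose f r := gamma * sinh (theta r) + alpha * theta r - 2 * Num.sqrt E * r.
have f_cst t : J t -> f t = f t0.
  move=> Jt; apply: (derive0_constant J_itv _ Jt Jt0) => {Jt} {}t Jt.
  have := is_derive_fctD (is_derive_fctD
      (is_derive_fctZ gamma (is_derive_fct_sinh (theta' _ Jt)))
      (is_derive_fctZ alpha (theta' _ Jt)))
    (is_derive_fctZ (- (2 * Num.sqrt E)) (is_derive_id t 1)).
  rewrite (_ : (fun _ => _) = f); last by apply/funext => r; rewrite /f mulNr.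
  move/is_derive_eq; apply.
  transitivity ((alpha + gamma * cosh (theta t)) * dtheta t - 2 * Num.sqrt E).
    by ring.
  by rewrite -xE// /dtheta; field.
exists (- f t0 / (2 * Num.sqrt E)).
apply: (radial_law_cosh J_itv theta' dtheta_gt0 gamma_gt0 xE) => t Jt.
by rewrite -(f_cst t)// /f; field.
Qed.

(** When gamma_i = 0, also alpha_i = b_i = 0, and the formula would force q_i = 0. The flow,
    however, then satisfies p_i^2 = E q_i^2 and admits Q_i proportional to exp theta or exp (-
    theta); [regular] excludes these motions. *)
Let regular i := gamma_ i = 0 -> forall t, J t -> q t 0 i = 0.

(** The pair (A_i, B_i) is (Y_i, P_i) rotated back to angle zero, and phi_i is its hyperbolic angle.
    The pairs (Y_i, P_i) add up to (x - alpha, S), so the rotated pairs add up to (gamma, 0). *)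
Lemma flow_angular_law : exists phi : 'I_n -> R,
  (forall i, regular i ->
    angular_law J x (fun t => q t 0 i ^+ 2) alpha gamma (alpha_ i) (gamma_ i)
      (phi i)) /\
  ((forall i, regular i) ->
    \sum_i gamma_ i * cosh (phi i) = gamma /\
    \sum_i gamma_ i * sinh (phi i) = 0).
Proof.
have [theta thetaP] := flow_phase.
have theta' r : J r -> is_derive r 1 theta (dtheta r) by case/thetaP.
have xE r : J r -> x r = alpha + gamma * cosh (theta r).
  by case/thetaP => _ <- _; rewrite addrC subrK.
pose A i := Y i t0 * cosh (theta t0) - P i t0 * sinh (theta t0).
pose B i := P i t0 * cosh (theta t0) - Y i t0 * sinh (theta t0).
have chsh := cosh_sqrB_sinh_sqr (theta t0).
have AB i : A i ^+ 2 - B i ^+ 2 = gamma_ i ^+ 2.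
  rewrite -(Y_sqrB i Jt0) -[RHS]mulr1 -chsh /A /B.
  by ring.
have /choice[phi phiP] : forall i, exists u, regular i ->
    A i = gamma_ i * cosh u /\ B i = gamma_ i * sinh u.
  move=> i.
  (* For gamma_i = 0, regularity gives A_i = B_i = 0 and any angle serves; 0 is taken. *)
  have [g0|g0] := eqVneq (gamma_ i) 0.
    exists 0 => /(_ g0 _ Jt0) q0; rewrite g0 !mul0r.
    have a0 : alpha_ i = 0.
      apply/eqP; rewrite -sqrf_eq0 eq_le sqr_ge0 andbT.
      have := gamma_i_sqr i; rewrite g0 expr0n/=.
      have : 0 <= b i / E by rewrite divr_ge0// ltW.
      by lra.
    by rewrite /A /B /Y /P q0 a0 expr0n/= !(mulr0, mul0r, subr0).
  have gi : 0 < gamma_ i by rewrite lt0r g0 sqrtr_ge0.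
  (* If A_i <= 0, squaring Y cosh theta <= P sinh theta gives (gamma_i^2 + P^2) (1 + sinh^2) <= P^2
     sinh^2, which is absurd. *)
  suff A0 : 0 < A i by have [u] := hyperbola_param A0 gi (AB i); exists u.
  rewrite /A subr_gt0 ltNge; apply/negP => le.
  have YC : 0 <= Y i t0 * cosh (theta t0).
    by rewrite mulr_ge0 ?Y_ge0// (le_trans ler01)// cosh_ge1.
  have := lerXn2r 2 YC (le_trans YC le) le.
  rewrite (exprMn 2 (Y i t0)) (exprMn 2 (P i t0)).
  have -> : Y i t0 ^+ 2 = gamma_ i ^+ 2 + P i t0 ^+ 2 by rewrite -(Y_sqrB i Jt0); ring.
  have -> : cosh (theta t0) ^+ 2 = 1 + sinh (theta t0) ^+ 2 by rewrite -chsh; ring.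
  have := exprn_gt0 2 gi; have := sqr_ge0 (P i t0); have := sqr_ge0 (sinh (theta t0)).
  by nra.
exists phi; split.
- move=> i ri; apply: (angular_law_cosh J_itv theta' dtheta_gt0 gamma_gt0 xE) => t Jt.
  have [Ai Bi] := phiP i ri.
  have := hyperbolic_oscillator_solution J_itv theta' (is_derive_Y i)
    (is_derive_P i) Jt0 (erefl (A i)) (erefl (B i)) Jt.
  by rewrite /Y Ai Bi coshD => /eqP; rewrite subr_eq => /eqP ->; ring.
- move=> reg; have [_ X0 S0] := thetaP _ Jt0.
  have sumY : \sum_i Y i t0 = gamma * cosh (theta t0).
    rewrite -X0 -sum_alpha_ /Y sumrB /x /dot.
    under [X in X - _ = _]eq_bigr do rewrite expr2.
    by ring.
  have sumP : \sum_i P i t0 = gamma * sinh (theta t0).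
    by rewrite -S0 /P -mulr_suml.
  have sumYM a : \sum_i Y i t0 * a = gamma * cosh (theta t0) * a.
    by rewrite -mulr_suml sumY.
  have sumPM a : \sum_i P i t0 * a = gamma * sinh (theta t0) * a.
    by rewrite -mulr_suml sumP.
  have sumA : \sum_i A i = gamma.
    rewrite sumrB sumYM sumPM -[RHS]mulr1 -chsh.
    by ring.
  have sumB : \sum_i B i = 0 by rewrite sumrB sumPM sumYM; ring.
  by split; [rewrite -[RHS]sumA|rewrite -[RHS]sumB]; apply: eq_bigr => i _;
    have [] := phiP i (reg i).
Qed.

End Flow.

(** * Assembly of the laws and recovery of an orbit from its parameters *)

Theorem mainTheorem2 (R : realType) (n : nat) (kappa omega2 : R)
    (b : 'I_n.+1 -> R) (J : set R) (q p : R -> 'rV[R]_n.+1) (t0 : R) :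
  0 < kappa -> 0 <= omega2 -> (forall j, 0 <= b j) ->
  kappa * omega2 != 0 ->
  open J -> is_interval J -> J t0 ->
  let c := kappa * omega2 in
  let H := hamiltonian kappa c b in
  (forall t, J t -> forall j, b j != 0 -> q t 0 j != 0) ->
  hamilton_solution H J q p ->
  let E := 2 * H (p t0) (q t0) in
  let C := integralC b (p t0) (q t0) in
  let I_ i := integralI kappa c b i (p t0) (q t0) in
  0 < E ->
  let alpha := (kappa - c / E) / 2 in
  let gamma := Num.sqrt ((kappa + c / E) ^+ 2 / 4 + C / E) in
  let alpha_ i := - (I_ i / (2 * E)) in
  let gamma_ i := Num.sqrt (alpha_ i ^+ 2 + b i / E) in
  let x t := kappa + dot (q t) (q t) in
  let Q (i : 'I_n.+1) t := q t 0 i ^+ 2 in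
  (* E, C and I_i are constant along the solution *)
  (forall t, J t ->
    [/\ 2 * H (p t) (q t) = E,
        integralC b (p t) (q t) = C &
        forall i, integralI kappa c b i (p t) (q t) = I_ i]) /\
  (* radial motion *)
  0 < gamma /\
  (forall t, J t -> alpha + gamma <= x t) /\
  (forall t, J t -> exists sigma S, half_orbit J x sigma S /\ S t) /\
  (exists tau, radial_law J x E alpha gamma tau) /\
  (forall y z, alpha + gamma <= y -> y < z ->
    radial_fun alpha gamma y < radial_fun alpha gamma z) /\
  set_bij `[alpha + gamma, +oo[ `[0, +oo[ (radial_fun alpha gamma) /\
  (* compatibility conditions that do not involve the phi_i *)
  \sum_i alpha_ i + kappa = alpha /\
  E = - (c / (kappa + 2 * \sum_i alpha_ i)) /\
  (* full solution; a coordinate with gamma_i = 0 obeys the formula only if it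
     vanishes identically *)
  let regular i := gamma_ i = 0 -> forall t, J t -> q t 0 i = 0 in
  (exists phi : 'I_n.+1 -> R,
    (forall i, regular i ->
      angular_law J x (Q i) alpha gamma (alpha_ i) (gamma_ i) (phi i)) /\
    ((forall i, regular i) ->
      [/\ \sum_i gamma_ i * cosh (phi i) = gamma,
          \sum_i gamma_ i * sinh (phi i) = 0 &
          \sum_i sinh (phi i) * Num.sqrt (alpha_ i ^+ 2 + E^-1 * b i) = 0])) /\
  ((forall i, regular i) ->
    (* recovery of the orbit from the 2 (n + 1) parameters tau, a, phi *)
    (exists (tau : R) (a : 'I_n -> R) (phi : 'I_n.+1 -> R) (z : R),
      let al := ord_rcons a z in
      let E' := - (c / (kappa + 2 * \sum_i al i)) in
      let ga i := Num.sqrt (al i ^+ 2 + b i / E') in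
      let alpha' := \sum_i al i + kappa in
      let gamma' := \sum_i ga i * cosh (phi i) in
      [/\ \sum_i sinh (phi i) * Num.sqrt (al i ^+ 2 + E'^-1 * b i) = 0,
          E = E',
          (forall i, I_ i = - (2 * E' * al i)) &
          C = E' * (gamma' ^+ 2 - (kappa + c / E') ^+ 2 / 4)] /\
      radial_law J x E' alpha' gamma' tau /\
      forall i, angular_law J x (Q i) alpha' gamma' (al i) (ga i) (phi i))).
Proof.
move=> kappa_gt0 omega2_ge0 b_ge0 komega J_open J_itv Jt0 c H bq flow E C I_ E_gt0.
move=> alpha gamma alpha_ gamma_ x Q.
have c_gt0 : 0 < c by rewrite lt0r komega mulr_ge0// ltW.
have bq' t : J t -> forall j, b j = 0 \/ q t 0 j != 0.
  move=> Jt j; have [bj|bj] := eqVneq (b j) 0; first by left.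
  by right; exact: bq.
have sum_alpha : \sum_i alpha_ i + kappa = alpha.
  exact: (sum_alpha_ kappa_gt0 J_itv Jt0 bq' flow E_gt0).
have EE : E = - (c / (kappa + 2 * \sum_i alpha_ i)).
  have -> : kappa + 2 * \sum_i alpha_ i = 2 * alpha - kappa.
    by rewrite -sum_alpha; ring.
  rewrite /alpha (_ : 2 * _ - kappa = - (c / E)); last by field; rewrite gt_eqF.
  by field; rewrite !gt_eqF.
have gamma0 : 0 < gamma by exact: gamma_gt0.
have alpha_gamma : 0 < alpha + gamma by exact: alpha_gamma_gt0.
have radial : exists tau, radial_law J x E alpha gamma tau.
  exact: flow_radial_law.
have [phi [ang sums]] :=
  flow_angular_law kappa_gt0 J_itv Jt0 bq' flow E_gt0 c_gt0 b_ge0.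
have sinh_sum : \sum_i gamma_ i * sinh (phi i) = 0 ->
    \sum_i sinh (phi i) * Num.sqrt (alpha_ i ^+ 2 + E^-1 * b i) = 0.
  move=> s0; rewrite -[RHS]s0; apply: eq_bigr => i _.
  by rewrite mulrC [_ * b i]mulrC.
split.
  move=> t Jt; split.
  - exact: (energy_constant kappa_gt0 J_itv Jt0 bq' flow).
  - exact: (integralC_constant kappa_gt0 J_itv Jt0 bq' flow).
  - exact: (integralI_constant kappa_gt0 J_itv Jt0 bq' flow).
split; first by [].
split; first exact: (x_ge kappa_gt0 J_itv Jt0 bq' flow E_gt0 c_gt0 b_ge0).
split.
  exact: (flow_half_orbit_cover kappa_gt0 J_itv Jt0 bq' flow E_gt0 c_gt0 b_ge0).
split; first by [].
split; first exact: radial_fun_increasing.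
split; first exact: radial_fun_bij.
split; first by [].
split; first by [].
move=> regular; split.
  exists phi; split; first exact: ang.
  by move=> reg; have [s1 s2] := sums reg; split => //; exact: sinh_sum.
move=> reg; have [s1 s2] := sums reg; have [tau tauP] := radial.
(* The parameters are read off from the orbit; the last alpha_i is supplied separately, as the
   quantity [z] tied to the others by the sinh constraint. *)
exists tau, (fun j => alpha_ (lift ord_max j)), phi, (alpha_ ord_max).
have -> : ord_rcons (fun j => alpha_ (lift ord_max j)) (alpha_ ord_max) = alpha_.
  apply/funext => i; rewrite /ord_rcons.
  by case: unliftP => [j ->|->].
move=> al E' ga alpha' gamma'.
have E'E : E' = E by rewrite [RHS]EE.
have gaE : ga = gamma_ by apply/funext => i; rewrite /ga E'E.
have gammaE : gamma' = gamma by rewrite /gamma' gaE.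
have alphaE : alpha' = alpha by [].
clearbody E' ga gamma' alpha'; subst E' ga gamma' alpha'.
split; last by split; [exact: tauP|move=> i; exact/ang/reg].
split => //.
- exact: sinh_sum.
- by move=> i; rewrite /al /alpha_; field; rewrite gt_eqF.
(* The definition of gamma is solved for C. *)
- rewrite (gamma_sqr E_gt0 b_ge0 : gamma ^+ 2 = _) -/C -/E; field.
  by rewrite gt_eqF.
Qed.
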